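(* Let $m\ge2$ and $S\subseteq\mathfrak{S}_{m+1}$. Suppose that the graph $G_S$ is strongly connected and that neither of the monotone permutations $12\cdots(m+1)$ and $(m+1)\cdots21$ belongs to $S$. Then the operator $T$ associated with $S$ is positivity improving.
   Context: For $x\in\mathbb{R}^n$ with pairwise distinct coordinates, $\Pi(x)\in\mathfrak{S}_n$ is the unique permutation $\pi$ with $\pi_i<\pi_j$ if and only if $x_i<x_j$. $G_S$ is the directed graph with vertex set $\mathfrak{S}_m$. It has a directed edge from $\pi$ to $\sigma$ if there is $\tau\in\mathfrak{S}_{m+1}\setminus S$ with $\Pi(\tau_1,\dots,\tau_m)=\pi$ and $\Pi(\tau_2,\dots,\tau_{m+1})=\sigma$. It is strongly connected if every vertex can be reached from every other vertex by a directed path. Define $\chi$ on $[0,1]^{m+1}$ by $\chi(x)=0$ if two coordinates coincide or if $\Pi(x)\in S$, and $\chi(x)=1$ otherwise. The operator $T$ on $L^2([0,1]^m)$ is $$(Tf)(x_1,\dots,x_m)=\int_0^1\chi(t,x_1,\dots,x_m)f(t,x_1,\dots,x_{m-1})\,dt.$$ A bounded operator $A$ on $L^2(X,\mu)$ is positivity improving if for every $f\ge0$ a.e. with $f\neq0$ there exists an integer $k$ (possibly depending on $f$) with $A^kf>0$ almost everywhere. *)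

(* Defs.v *)
From HB Require Import structures.
From mathcomp Require Import all_boot all_order all_algebra all_fingroup.
From mathcomp Require Import all_classical all_reals all_analysis measurable_realfun ring.
Set Implicit Arguments.
Unset Strict Implicit.
Unset Printing Implicit Defensive.
Import Order.TTheory GRing.Theory Num.Theory.
Import numFieldNormedType.Exports.
Local Open Scope classical_set_scope.
Local Open Scope ring_scope.

(* The default value [1] is reached only when [x] is not injective, see [PiP]
   and [Pi_unique]. *)
Definition Pi d (T : orderType d) n (x : 'I_n -> T) : 'S_n :=
  odflt 1%g
    [pick p : 'S_n | [forall i, forall j, (p i < p j)%N == (x i < x j)%O]].

Section Pi_spec.
Context d (T : orderType d) (n : nat) (x : 'I_n -> T).

Let rank (i : 'I_n) : nat := #|[pred j | (x j < x i)%O]|.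

Let perm_rank (p : 'S_n) (i : 'I_n) :
  (forall i j, (p i < p j)%N = (x i < x j)%O) -> p i = rank i :> nat.
Proof.
move=> px; rewrite /rank -sum1_card.
rewrite (eq_bigl (fun j => (p j < p i)%N)) => [|j]; last by rewrite inE px.
transitivity (\sum_(j < n | (j < p i)%N) 1)%N; last exact: (reindex_inj (@perm_inj _ p)).
by rewrite -(big_ord_widen _ (fun=> 1%N) (ltnW (ltn_ord _))) sum1_card card_ord.
Qed.

Lemma PiP : injective x -> forall i j, (Pi x i < Pi x j)%N = (x i < x j)%O.
Proof.
move=> xI; have rank_mono i j : (x i < x j)%O -> (rank i < rank j)%N.
  move=> xij; apply/proper_card/properP; split.
    by apply/fintype.subsetP => k; rewrite !inE => /lt_trans; apply.
  by exists i; rewrite inE ?ltxx.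
have rankE i j : (rank i < rank j)%N = (x i < x j)%O.
  apply/idP/idP => [|/rank_mono//]; apply: contraTT; rewrite -leNgt -leqNgt.
  rewrite le_eqVlt => /predU1P[/xI ->//|/rank_mono/ltnW//].
have rank_lt i : (rank i < n)%N.
  rewrite -[ltnRHS]card_ord; apply/proper_card/properP.
  by split; [exact/fintype.subsetP|exists i; rewrite !inE ?ltxx].
have rank_inj : injective (fun i => Ordinal (rank_lt i)).
  move=> i j [] rij; apply: xI; apply/eqP.
  by case: ltgtP => // /rank_mono; rewrite rij ltnn.
rewrite /Pi; case: pickP => [p /forallP px i j|/(_ (perm rank_inj))/negP[]].
  by have /forallP/(_ j)/eqP := px i.
by apply/forallP => i; apply/forallP => j; rewrite !permE/= rankE.
Qed.

Lemma Pi_unique (p : 'S_n) : injective x ->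
  (forall i j, (p i < p j)%N = (x i < x j)%O) -> p = Pi x.
Proof.
move=> xI px; apply/permP => i; apply: val_inj => /=.
by rewrite (perm_rank _ px) (perm_rank _ (PiP xI)).
Qed.

End Pi_spec.

Definition edge m (S : {set 'S_m.+1}) : rel 'S_m := fun p q =>
  [exists t : 'S_m.+1, [&& t \notin S,
    Pi (fun i : 'I_m => t (widen_ord (leqnSn m) i)) == p &
    Pi (fun i : 'I_m => t (lift ord0 i)) == q]].

Definition strongly_connected (V : finType) (e : rel V) := forall p q, connect e p q.

(* The permutations [12...n] and [n...21] in one-line notation. *)
Definition increasing_perm n : 'S_n := 1%g.
Definition decreasing_perm n : 'S_n := perm (@rev_ord_inj n).

(* [LspaceType2 mu] is the library's space of a.e.-classes of square-integrable
   functions; it carries no module structure, hence linearity is stated through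
   a.e. equality of representatives. *)
Section bounded_operator.
Context d (X : measurableType d) (R : realType) (mu : {measure set X -> \bar R}).
Local Notation L2 := (LspaceType2 mu).

Record bounded_operator := BoundedOperator {
  op_fun :> L2 -> L2 ;
  op_linear : forall (a : R) (f g h : L2),
    h = (fun x => a * f x + g x) %[ae mu] ->
    op_fun h = (fun x => a * op_fun f x + op_fun g x) %[ae mu] ;
  op_bounded : exists C : R, forall f : L2,
    ('N[mu]_2%:E[EFin \o op_fun f] <= C%:E * 'N[mu]_2%:E[EFin \o f])%E }.

Definition positivity_improving (A : bounded_operator) : Prop :=
  forall f : L2, {ae mu, forall x, 0 <= f x} -> ~ (f = cst 0 %[ae mu]) ->
  exists k : nat, {ae mu, forall x, 0 < iter k A f x}.

Lemma measurable_norm2 (f : X -> R) : measurable_fun setT f ->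
  measurable_fun setT (fun x => `|(f x)%:E| `^ 2)%E.
Proof.
move=> mf; apply: (measurableT_comp (measurable_poweR _)) => //=.
apply/measurable_EFinP; exact: measurableT_comp.
Qed.

Lemma ae_eq_Lnorm2 (f g : X -> R) :
  measurable_fun setT f -> measurable_fun setT g -> f = g %[ae mu] ->
  ('N[mu]_2%:E[EFin \o f] = 'N[mu]_2%:E[EFin \o g])%E.
Proof.
move=> mf mg fg; rewrite unlock; congr (_ `^ _)%E.
apply: ae_eq_integral => //; [exact: measurable_norm2..|].
by apply: filterS fg => x /= /(_ I) ->.
Qed.

Lemma measurable_L2 (f : L2) : measurable_fun setT (f : X -> R).
Proof. exact: (measurable_funP (generic_quotient.repr (f : {mfun_ mu, _ >-> _}))). Qed.

Lemma finite_norm_L2 (f : L2) : finite_norm mu 2%:E (f : X -> R).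
Proof. exact: Lebesgue_finite. Qed.

Section L2_of.
Context (f : X -> R) (mf : measurable_fun setT f) (ff : finite_norm mu 2%:E f).

Let f_mfun : {mfun X >-> measurableTypeR R} :=
  HB.pack (f : X -> measurableTypeR R)
    (isMeasurableFun.Build _ _ _ _ (f : X -> measurableTypeR R) mf).

Let cls : {mfun_ mu, X >-> measurableTypeR R} := \pi_(aeEqMfun _ mu)%qT f_mfun.

Let clsE : cls = f %[ae mu].
Proof.
have /eqquotP : (generic_quotient.repr cls = f_mfun %[mod aeEqMfun _ mu])%qT.
  by rewrite reprK.
by move/asboolP.
Qed.

Let cls_finite : finite_norm mu 2%:E cls.
Proof.
rewrite /finite_norm (ae_eq_Lnorm2 _ mf clsE)//.
exact: (measurable_funP (generic_quotient.repr cls)).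
Qed.

Definition L2_of : L2 := HB.pack cls (isFinLebesgue.Build _ _ _ _ _ _ cls cls_finite).

Lemma L2_ofE : L2_of = f %[ae mu].
Proof. exact: clsE. Qed.

End L2_of.
End bounded_operator.

Section cube.
Context (R : realType).
Local Notation T := (measurableTypeR R).
Local Notation U := (uniform_prob (@ltr01 R)).

Definition tuple_cons n (x : T * n.-tuple T) : n.+1.-tuple T :=
  [tuple of x.1 :: x.2].

Lemma measurable_tuple_cons n : measurable_fun setT (@tuple_cons n).
Proof. by apply: measurable_cons. Qed.

HB.instance Definition _ n := isMeasurableFun.Build _ _ _ _ (@tuple_cons n)
  (@measurable_tuple_cons n).

(* The n-fold product of Lebesgue measure on [0, 1]: the Lebesgue measure of the
   cube [0, 1]^n, seen as a measure on R^n that vanishes outside the cube. Thus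
   [LspaceType2 (cube_measure n)] is L^2([0, 1]^n). *)
Fixpoint cube_measure n : probability (n.-tuple T) R :=
  match n with
  | 0 => \d_[tuple]
  | n.+1 => distribution (U \x cube_measure n)%E (@tuple_cons n)
  end.

Lemma ge0_integral_cubeS n (g : n.+1.-tuple T -> \bar R) :
  measurable_fun setT g -> (forall x, 0 <= g x)%E ->
  (\int[cube_measure n.+1]_x g x =
   \int[U]_t \int[cube_measure n]_y g (tuple_cons (t, y)))%E.
Proof.
move=> mg g0.
rewrite /= ge0_integral_pushforward//= preimage_setT.
rewrite fubini_tonelli1//=.
by apply: measurableT_comp.
Qed.

(* (t, (x_1, ..., x_n)) |-> (t, x_1, ..., x_(n-1)) *)
Definition tuple_shift n (x : T * n.-tuple T) : n.-tuple T :=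
  [tuple of belast x.1 x.2].

Lemma measurable_tuple_shift n : measurable_fun setT (@tuple_shift n).
Proof.
apply/measurable_fun_tnthP => i.
rewrite (_ : _ \o _ = (fun x => tnth (tuple_cons x) (widen_ord (leqnSn n) i))).
  apply: (measurableT_comp (f := fun x : n.+1.-tuple T => tnth x _)) => //.
  exact: measurable_tnth.
apply/funext => -[t x] /=.
rewrite !(tnth_nth t)/= -[t :: x]/(t :: val x) lastI nth_rcons size_belast.
by rewrite size_tuple ltn_ord.
Qed.

Lemma ge0_integral_shift n (g : n.-tuple T -> \bar R) :
  measurable_fun setT g -> (forall x, 0 <= g x)%E ->
  (\int[cube_measure n]_x \int[U]_t g (tuple_shift (t, x)) =
   \int[cube_measure n]_x g x)%E.
Proof.
elim: n g => [|n IH] g mg g0.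
  transitivity (\int[cube_measure 0]_x (cst (g [tuple])) x)%E; last first.
    by apply: eq_integral => x _ /=; rewrite [x]tuple0.
  apply: eq_integral => x _ /=.
  under eq_integral do rewrite [tuple_shift _]tuple0.
  rewrite integral_cst// [X in (_ * X)%E](_ : _ = 1%E) ?mule1//.
  exact: (probability_setT U).
rewrite ge0_integral_cubeS//; last 2 first.
  apply: (measurable_fun_fubini_tonelli_G (m1 := U) (g \o @tuple_shift n.+1)) => //=.
  by apply: measurableT_comp => //; exact: measurable_tuple_shift.
  by move=> x; apply: integral_ge0.
rewrite ge0_integral_cubeS//.
have E (a t : T) (y : n.-tuple T) : tuple_shift (t, tuple_cons (a, y)) =
    tuple_cons (t, tuple_shift (a, y)) by exact/val_inj.
under eq_integral.
  move=> a _; under eq_integral.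
    move=> y _; under eq_integral do rewrite E; over.
  over.
have mcc d (Y : measurableType d) (u v : Y -> T) (w : Y -> n.-tuple T) :
    measurable_fun setT u -> measurable_fun setT v -> measurable_fun setT w ->
    measurable_fun setT (fun p => g (tuple_cons (u p, tuple_shift (v p, w p)))).
  move=> mu mv mw; apply: (measurableT_comp mg).
  apply: (measurableT_comp (@measurable_tuple_cons _)).
  apply: measurable_fun_pair => //=.
  apply: (measurableT_comp (@measurable_tuple_shift _)).
  exact: measurable_fun_pair.
transitivity (\int[U]_a \int[U]_t \int[cube_measure n]_y g (tuple_cons (t, tuple_shift (a, y))))%E.
  apply: eq_integral => a _.
  rewrite [RHS](@fubini_tonelli _ _ _ _ _ U (cube_measure n)
    (fun p => g (tuple_cons (p.1, tuple_shift (a, p.2)))))//=.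
  apply: (mcc _ _ (fun p => p.1) (fun=> a) (fun p => p.2)) => //.
    exact: measurable_fst.
  exact: measurable_snd.
transitivity (\int[U]_t \int[U]_a \int[cube_measure n]_y g (tuple_cons (t, tuple_shift (a, y))))%E.
  apply: (@fubini_tonelli _ _ _ _ _ U U (fun p =>
    \int[cube_measure n]_y g (tuple_cons (p.2, tuple_shift (p.1, y))))%E).
  - apply: (@measurable_fun_fubini_tonelli_F _ _ _ _ _ (cube_measure n)
      (fun p : (T * T) * n.-tuple T => g (tuple_cons (p.1.2, tuple_shift (p.1.1, p.2))))) => //=.
    apply: (mcc _ _ (fun p => p.1.2) (fun p => p.1.1) (fun p => p.2)).
    + exact: (measurableT_comp measurable_snd measurable_fst).
    + exact: (measurableT_comp measurable_fst measurable_fst).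
    + exact: measurable_snd.
  - by move=> x; apply: integral_ge0.
apply: eq_integral => t _.
transitivity (\int[cube_measure n]_y \int[U]_a g (tuple_cons (t, tuple_shift (a, y))))%E.
  apply: (@fubini_tonelli _ _ _ _ _ U (cube_measure n)
    (fun p => g (tuple_cons (t, tuple_shift p)))) => //.
  apply: (mcc _ _ (fun=> t) (fun p => p.1) (fun p => p.2)) => //.
    exact: measurable_fst.
  exact: measurable_snd.
rewrite (IH (fun y => g (tuple_cons (t, y))))//.
apply: (measurableT_comp mg); apply: (measurableT_comp (@measurable_tuple_cons _)).
exact: measurable_fun_pair.
Qed.

End cube.

Section operator.
Context (R : realType).
Local Notation T := (measurableTypeR R).
Local Notation U := (uniform_prob (@ltr01 R)).

(* Defined by the same formula on all of R^n; only its values on the cube [0, 1]^n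
   are used. *)
Definition chi n (S : {set 'S_n}) (x : n.-tuple R) : R :=
  if ~~ uniq x || (Pi (tnth x) \in S) then 0 else 1.

Lemma chi_ge0 n (S : {set 'S_n}) x : 0 <= chi S x.
Proof. by rewrite /chi; case: ifP. Qed.

Lemma chi_le1 n (S : {set 'S_n}) x : chi S x <= 1.
Proof. by rewrite /chi; case: ifP. Qed.

Lemma measurable_chi n (S : {set 'S_n}) :
  measurable_fun [set: n.-tuple T] (chi S : n.-tuple T -> R).
Proof.
pose cmp (x : n.-tuple R) : {ffun 'I_n * 'I_n -> bool} :=
  [ffun p => tnth x p.1 < tnth x p.2].
pose G (b : {ffun 'I_n * 'I_n -> bool}) : R :=
  if ~~ [forall i, forall j, (i != j) ==> b (i, j) || b (j, i)] ||
    (odflt 1%g [pick p : 'S_n | [forall i, forall j, (p i < p j)%N == b (i, j)]] \in S)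
  then 0 else 1.
have chiE x : chi S x = G (cmp x).
  have E1 : uniq x = [forall i, forall j, (i != j) ==> cmp x (i, j) || cmp x (j, i)].
    apply/tuple_uniqP/forallP => [xi i|H i j xij].
      apply/forallP => j; apply/implyP => ij; rewrite !ffunE/=.
      by rewrite -neq_lt (inj_eq xi).
    apply/eqP; apply: contraT => ij.
    move: (H i) => /forallP/(_ j)/implyP/(_ ij); rewrite !ffunE/=.
    by rewrite xij ltxx.
  have E2 : Pi (tnth x) = odflt 1%g
      [pick p : 'S_n | [forall i, forall j, (p i < p j)%N == cmp x (i, j)]].
    congr odflt; apply: eq_pick => p.
    by apply/forallP/forallP => H i; apply/forallP => j;
      move: (H i) => /forallP/(_ j); rewrite ffunE.
  by rewrite /chi /G -E1 -E2.
have mcmp b : measurable [set x : n.-tuple T | cmp x = b].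
  rewrite (_ : [set _ | _] = \bigcap_(p in [set: 'I_n * 'I_n])
      [set x : n.-tuple T | ((tnth x p.1 : R) < tnth x p.2) = b p]); last first.
    apply/seteqP; split => [x <- p _|x H]/=; first by rewrite ffunE.
    by apply/ffunP => p; rewrite ffunE; exact: H.
  apply: fin_bigcap_measurable => // p _.
  rewrite -[X in measurable X]setTI.
  have := @measurable_fun_ltr _ _ R setT (fun x : n.-tuple T => tnth x p.1)
    (fun x => tnth x p.2) (@measurable_tnth _ _ _ _) (@measurable_tnth _ _ _ _).
  exact: (fun H => H measurableT [set b p] I).
move=> _ A mA; rewrite setTI.
rewrite (_ : _ @^-1` _ = \bigcup_(b in [set b | A (G b)]) [set x : n.-tuple T | cmp x = b]).
  exact: fin_bigcup_measurable.
apply/seteqP; split => [x /=|x [b /= Ab cb]].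
  by rewrite chiE => Ax; exists (cmp x).
by rewrite chiE cb.
Qed.

Lemma integral_unif (f : T -> \bar R) : measurable_fun setT f ->
  (\int[U]_t f t = \int[lebesgue_measure]_(t in `[0%R, 1%R]) f t)%E.
Proof.
move=> mf; rewrite integralE [RHS]integralE.
have i1 : ((1 - 0 : R)^-1%:E = 1)%E by rewrite subr0 invr1.
rewrite (integral_uniform ltr01 (measurable_funepos mf))// i1 mul1e.
by rewrite (integral_uniform ltr01 (measurable_funeneg mf))// i1 mul1e.
Qed.

Context (m : nat) (S : {set 'S_m.+1}).
Local Notation P := (cube_measure R m).

(* [t :: x] is (t, x_1, ..., x_m) and [belast t x] is (t, x_1, ..., x_(m-1)). *)
Definition Tfun (f : m.-tuple R -> R) (x : m.-tuple R) : R :=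
  \int[lebesgue_measure]_(t in `[0, 1])
    (chi S [tuple of t :: x] * f [tuple of belast t x]).

Let h (f : m.-tuple T -> R) (z : T * m.-tuple T) : R :=
  chi S (tuple_cons z) * f (tuple_shift z).

Let mh f : measurable_fun setT f -> measurable_fun setT (h f).
Proof.
move=> mf; apply: measurable_funM.
  exact: (measurableT_comp (measurable_chi S) (@measurable_tuple_cons R m)).
exact: (measurableT_comp mf (@measurable_tuple_shift R m)).
Qed.

Let mhx f x : measurable_fun setT f -> measurable_fun setT (fun t => h f (t, x)).
Proof.
by move=> mf; exact: (measurable_fun_pair1 x (mh mf)).
Qed.

Lemma TfunE f x : measurable_fun setT f -> Tfun f x = (\int[U]_t h f (t, x))%R.
Proof.
move=> mf; rewrite /Rintegral integral_unif//.
by apply/measurable_EFinP; exact: mhx.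
Qed.

Lemma measurable_Tfun (f : m.-tuple T -> R) :
  measurable_fun setT f -> measurable_fun setT (Tfun f : m.-tuple T -> R).
Proof.
move=> mf.
rewrite (_ : Tfun f = fine \o (fun x => \int[U]_t ((EFin \o h f)^\+)%E (t, x) -
   \int[U]_t ((EFin \o h f)^\-)%E (t, x))%E); last first.
  apply/funext => x; rewrite TfunE// /Rintegral integralE /=.
  by congr (fine (_ - _)); apply: eq_integral => t _; rewrite ?funeposE ?funenegE.
have mH : measurable_fun setT (EFin \o h f) by apply/measurable_EFinP; exact: mh.
apply: (measurableT_comp (fine_measurable measurableT)) => //.
apply: emeasurable_funB.
  by apply: (measurable_fun_fubini_tonelli_G (m1 := U) ((EFin \o h f)^\+)%E) => //; exact: measurable_funepos.
by apply: (measurable_fun_fubini_tonelli_G (m1 := U) ((EFin \o h f)^\-)%E) => //; exact: measurable_funeneg.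
Qed.

Let Lnorm12 d (X : measurableType d) (Q : probability X R) (u : X -> R) :
  measurable_fun setT u -> ('N[Q]_1[EFin \o u] <= 'N[Q]_2%:E[EFin \o u])%E.
Proof.
move=> mu; have := @hoelder _ _ _ Q u (cst 1) 2 2 mu (measurable_cst _).
rewrite (_ : EFin \o (u \* cst 1)%R = EFin \o u); last first.
  by apply/funext => t /=; rewrite mulr1.
have -> : ('N[Q]_2%:E[EFin \o cst 1%R] = 1)%E.
  rewrite (Lnorm_cst1 Q 2) [X in (X `^ _)%E](_ : _ = 1%E) ?poweR1r//.
  exact: probability_setT.
by rewrite mule1; apply => //; rewrite -div1r -splitr.
Qed.

Let int_sqr_le (u : T -> R) : measurable_fun setT u ->
  ((\int[U]_t `|(u t)%:E|) `^ 2 <= \int[U]_t `|(u t)%:E| `^ 2)%E.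
Proof.
move=> mu; have le12 := Lnorm12 U mu.
rewrite -(@poweR_Lnorm _ _ _ U (EFin \o u) 2)// -(Lnorm1 U (EFin \o u)).
by apply: gt0_ler_poweR => //; rewrite in_itv/= leey Lnorm_ge0.
Qed.

Let mshiftx (g : m.-tuple T -> \bar R) x : measurable_fun setT g ->
  measurable_fun setT (fun t => g (tuple_shift (t, x))).
Proof.
move=> mg.
exact: (measurable_fun_pair1 x (measurableT_comp mg (@measurable_tuple_shift R m))).
Qed.

Let msqr (f : m.-tuple T -> R) : measurable_fun setT f ->
  measurable_fun setT (fun x => `|(f x)%:E| `^ 2)%E.
Proof. exact: measurable_norm2. Qed.

Let h_le f t x : (`|(h f (t, x))%:E| <= `|(f (tuple_shift (t, x)))%:E|)%E.
Proof.
rewrite !abse_EFin lee_fin /h normrM -[leRHS]mul1r ler_wpM2r//.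
by rewrite ger0_norm ?chi_ge0 ?chi_le1.
Qed.

Let le_sqr (x y : \bar R) : (0 <= x -> x <= y -> x `^ 2 <= y `^ 2)%E.
Proof.
move=> x0 xy; apply: gt0_ler_poweR => //; rewrite in_itv/= leey ?x0//.
by rewrite (le_trans x0 xy).
Qed.

Let Tfun_sqr_le f x : measurable_fun setT f ->
  (`|(Tfun f x)%:E| `^ 2 <= \int[U]_t `|(f (tuple_shift (t, x)))%:E| `^ 2)%E.
Proof.
move=> mf; have mhE : measurable_fun setT (fun t => (h f (t, x))%:E).
  by apply/measurable_EFinP; exact: mhx.
have msE : measurable_fun setT (fun t => `|(f (tuple_shift (t, x)))%:E| `^ 2)%E.
  exact: (@mshiftx (fun y => `|(f y)%:E| `^ 2)%E x (msqr mf)).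
apply: (@le_trans _ _ ((\int[U]_t `|(h f (t, x))%:E|) `^ 2)%E).
  apply: le_sqr => //.
  apply: le_trans (le_abse_integral U measurableT mhE).
  rewrite TfunE// /Rintegral.
  by case: (\int[U]_t _)%E => //= *; rewrite ?normr0 ?leey.
apply: le_trans (int_sqr_le (mhx x mf)) _.
apply: ge0_le_integral => //.
- by move=> t _; exact: poweR_ge0.
- exact: (measurable_norm2 (mhx x mf)).
- by move=> t _; apply: le_sqr => //; exact: h_le.
Qed.

Lemma Lnorm_Tfun f : measurable_fun setT f ->
  ('N[P]_2%:E[EFin \o Tfun f] <= 'N[P]_2%:E[EFin \o f])%E.
Proof.
move=> mf; rewrite unlock; apply: gt0_ler_poweR => //.
- by rewrite in_itv/= leey integral_ge0// => x _; exact: poweR_ge0.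
- by rewrite in_itv/= leey integral_ge0// => x _; exact: poweR_ge0.
rewrite -(ge0_integral_shift (msqr mf)); last by move=> x; exact: poweR_ge0.
apply: ge0_le_integral => //.
- by move=> x _; exact: poweR_ge0.
- exact: (measurable_norm2 (measurable_Tfun mf)).
- apply: (@measurable_fun_fubini_tonelli_G _ _ _ _ _ U
    (fun z => `|(f (tuple_shift z))%:E| `^ 2)%E).
    exact: (measurableT_comp (msqr mf) (@measurable_tuple_shift R m)).
  by move=> x; exact: poweR_ge0.
- by move=> x _; exact: Tfun_sqr_le.
Qed.

Let mabs (f : m.-tuple T -> R) : measurable_fun setT f ->
  measurable_fun setT (fun x => `|(f x)%:E|)%E.
Proof. by move=> mf; apply: measurableT_comp => //; exact/measurable_EFinP. Qed.

Let ae_shift_integrable f : measurable_fun setT f -> finite_norm P 2%:E f ->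
  {ae P, forall x, U.-integrable setT (fun t => (f (tuple_shift (t, x)))%:E)}.
Proof.
move=> mf ff.
pose F x := (\int[U]_t `|(f (tuple_shift (t, x)))%:E|)%E.
have mF : measurable_fun setT F.
  apply: (@measurable_fun_fubini_tonelli_G _ _ _ _ _ U
    (fun z => `|(f (tuple_shift z))%:E|)%E) => //.
  exact: (measurableT_comp (mabs mf) (@measurable_tuple_shift R m)).
have iF : P.-integrable setT F.
  apply/integrableP; split => //.
  under eq_integral do rewrite gee0_abs ?integral_ge0//.
  rewrite (ge0_integral_shift (mabs mf))// -(Lnorm1 P (EFin \o f)).
  exact: le_lt_trans (Lnorm12 P mf) ff.
have := integrable_ae measurableT iF.
apply: filterS => x /(_ I) Fx; apply/integrableP; split.
  by apply: (@mshiftx (EFin \o f) x); exact/measurable_EFinP.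
by rewrite ltey_eq Fx.
Qed.

Let ae_shift0 (f : m.-tuple T -> R) :
  measurable_fun setT f -> {ae P, forall x, f x = 0} ->
  {ae P, forall x, (\int[U]_t `|(f (tuple_shift (t, x)))%:E| = 0)%E}.
Proof.
move=> mf f0.
pose F x := (\int[U]_t `|(f (tuple_shift (t, x)))%:E|)%E.
have F0 x : (0 <= F x)%E by exact: integral_ge0.
have mF : measurable_fun setT F.
  apply: (@measurable_fun_fubini_tonelli_G _ _ _ _ _ U
    (fun z => `|(f (tuple_shift z))%:E|)%E) => //.
  exact: (measurableT_comp (mabs mf) (@measurable_tuple_shift R m)).
have : (\int[P]_x `|F x| = 0)%E.
  under eq_integral do rewrite gee0_abs//.
  rewrite (ge0_integral_shift (mabs mf))//.
  apply/ae_eq_integral_abs => //; first exact/measurable_EFinP.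
  by apply: filterS f0 => x /= ->.
move/ae_eq_integral_abs => /(_ measurableT mF).
by apply: filterS => x /(_ I).
Qed.

Lemma ae_Tfun_linear (a : R) (f g k : m.-tuple T -> R) :
  measurable_fun setT f -> measurable_fun setT g -> measurable_fun setT k ->
  finite_norm P 2%:E f -> finite_norm P 2%:E g ->
  k = (fun x => a * f x + g x) %[ae P] ->
  Tfun k = (fun x => a * Tfun f x + Tfun g x) %[ae P].
Proof.
move=> mf mg mk ff fg kE.
pose u x := k x - (a * f x + g x).
have mu : measurable_fun setT u.
  apply: measurable_funB => //; apply: measurable_funD => //.
  exact: measurable_funM.
have u0 : {ae P, forall x, u x = 0}.
  by apply: filterS kE => x /(_ I) kx; rewrite /u kx subrr.
have ih v x : measurable_fun setT v ->
    U.-integrable setT (fun t => (v (tuple_shift (t, x)))%:E) ->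
    U.-integrable setT (EFin \o (fun t => h v (t, x))).
  move=> mv; apply: le_integrable => //.
    by apply/measurable_EFinP; exact: mhx.
  by move=> t _; exact: h_le.
apply: filterS3 (ae_shift_integrable mf ff) (ae_shift_integrable mg fg)
  (ae_shift0 mu u0) => x fx gx ux _.
rewrite !TfunE// -RintegralZl//; last exact: ih.
rewrite -RintegralD//; last 2 first.
- rewrite (_ : _ \o _ = (fun t => a%:E * (EFin \o (fun t => h f (t, x))) t)%E)//.
  by apply: integrableZl => //; exact: ih.
- exact: ih.
rewrite /Rintegral; congr fine; apply: ae_eq_integral => //.
- by apply/measurable_EFinP; exact: mhx.
- apply/measurable_EFinP; apply: measurable_funD; last exact: mhx.
  by apply: measurable_funM => //; exact: mhx.
have : (fun t => (u (tuple_shift (t, x)))%:E) = cst 0%E %[ae U].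
  apply/ae_eq_integral_abs => //.
  by apply: (@mshiftx (EFin \o u) x); exact/measurable_EFinP.
apply: filterS => t /(_ I) /= [ut0] _; congr EFin.
move/eqP: ut0; rewrite /u subr_eq0 => /eqP ut0.
by rewrite /h /= ut0; ring.
Qed.

Local Notation L2 := (LspaceType2 P).

Lemma Tfun_finite (f : L2) : finite_norm P 2%:E (Tfun f).
Proof.
apply: (le_lt_trans (Lnorm_Tfun (measurable_L2 f))).
exact: finite_norm_L2.
Qed.

Definition pattern_operator_fun (f : L2) : L2 :=
  L2_of (measurable_Tfun (measurable_L2 f)) (Tfun_finite f).

Lemma pattern_operator_funE (f : L2) : pattern_operator_fun f = Tfun f %[ae P].
Proof. exact: L2_ofE. Qed.

Lemma pattern_operator_linear (a : R) (f g k : L2) :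
  k = (fun x => a * f x + g x) %[ae P] ->
  pattern_operator_fun k =
  (fun x => a * pattern_operator_fun f x + pattern_operator_fun g x) %[ae P].
Proof.
move=> kE.
have := ae_Tfun_linear (measurable_L2 f) (measurable_L2 g) (measurable_L2 k)
  (finite_norm_L2 f) (finite_norm_L2 g) kE.
apply: filterS3 (pattern_operator_funE f) (filterI (pattern_operator_funE g)
  (pattern_operator_funE k)) => x.
by move=> /(_ I) Ef [/(_ I) Eg /(_ I) Ek] /(_ I) E _; rewrite Ef Eg Ek.
Qed.

Lemma pattern_operator_bounded : exists C : R, forall f : L2,
  ('N[P]_2%:E[EFin \o pattern_operator_fun f] <= C%:E * 'N[P]_2%:E[EFin \o f])%E.
Proof.
exists 1 => f; rewrite mul1e.
rewrite (ae_eq_Lnorm2 (measurable_L2 _) (measurable_Tfun (measurable_L2 f))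
  (pattern_operator_funE f)).
exact: Lnorm_Tfun (measurable_L2 f).
Qed.

Definition pattern_operator : bounded_operator P :=
  BoundedOperator pattern_operator_linear pattern_operator_bounded.

End operator.

(* Main.v *)
Require Import Defs.
From HB Require Import structures.
From mathcomp Require Import all_boot all_order all_algebra all_fingroup.
From mathcomp Require Import all_classical all_reals all_analysis measurable_realfun.
From mathcomp Require Import zify lra.
Set Implicit Arguments.
Unset Strict Implicit.
Unset Printing Implicit Defensive.
Import Order.TTheory GRing.Theory Num.Theory.
Import numFieldNormedType.Exports.
Local Open Scope ring_scope.

(* Iterating the definition, T^k f(x) is the integral over y in [0,1]^k of
   W(y, x) f(first m letters of yx), where W(y, x) is the indicator of the words yx
   all of whose windows of length m+1 have a pattern outside S; the theorem follows
   once T^k f is positive at almost every x for a single k > m.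

   For k = m + N write y = zw with z in [0,1]^m. For N large and generic z, x there
   is some w such that zwx has only good windows: extending a word along an edge of
   G_S is always possible inside any open interval containing the last window, so
   from z one reaches a decreasing window, decreases below a level beta (the pattern
   m+1...1 is allowed), reaches an increasing window while staying below beta, and
   increases (the pattern 1...m+1 is allowed) up to an increasing window above beta
   from which x is reached. The increasing run absorbs any length, which makes N
   independent of z and x. The condition is open in w, so the integral over w is
   positive for almost every z, and then so is the integral against f. *)

(** * Patterns and the insertion of one value at a prescribed rank *)

Section order_patterns.

Lemma eq_Pi d1 (T1 : orderType d1) d2 (T2 : orderType d2) n
    (x : 'I_n -> T1) (y : 'I_n -> T2) :
  (forall i j, (x i < x j)%O = (y i < y j)%O) -> Pi x = Pi y.
Proof.
move=> xy; rewrite /Pi; congr odflt; apply: eq_pick => p.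
by apply: eq_forallb => i; apply: eq_forallb => j; rewrite xy.
Qed.

(** In a total order, equal values are exactly those not strictly comparable, so the strict
    comparisons alone decide injectivity. *)
Lemma same_order_inj d1 (T1 : orderType d1) d2 (T2 : orderType d2) n
    (x : 'I_n -> T1) (y : 'I_n -> T2) :
  (forall i j, (x i < x j)%O = (y i < y j)%O) -> injective x -> injective y.
Proof.
move=> xy xI i j yij; apply: xI; apply/eqP.
by case: ltgtP (xy i j) (xy j i); rewrite // yij ltxx => // _.
Qed.

Lemma Pi_increasing d (T : orderType d) n (x : 'I_n -> T) :
  (forall i j : 'I_n, (i < j)%N -> (x i < x j)%O) -> Pi x = increasing_perm n.
Proof.
move=> xm; have H (i j : 'I_n) : (i < j)%N = (x i < x j)%O.
  apply/idP/idP => [|]; first exact: xm.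
  case: (ltngtP i j) => // [/xm|/ord_inj ->]; last by rewrite ltxx.
  by move=> /ltW; rewrite leNgt => /negbTE ->.
apply/esym/Pi_unique => [i j xij|i j]; last by rewrite /increasing_perm !perm1 H.
by apply: ord_inj; case: (ltngtP i j) (H i j) (H j i); rewrite // xij ltxx => // _.
Qed.

Lemma Pi_decreasing d (T : orderType d) n (x : 'I_n -> T) :
  (forall i j : 'I_n, (i < j)%N -> (x j < x i)%O) -> Pi x = decreasing_perm n.
Proof.
move=> xm; have H (i j : 'I_n) : (j < i)%N = (x i < x j)%O.
  apply/idP/idP => [|]; first exact: xm.
  case: (ltngtP j i) => // [/xm|/ord_inj ->]; last by rewrite ltxx.
  by move=> /ltW; rewrite leNgt => /negbTE ->.
apply/esym/Pi_unique => [i j xij|i j]; last first.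
  by rewrite /decreasing_perm !permE /= -H; have := ltn_ord i; have := ltn_ord j; lia.
by apply: ord_inj; case: (ltngtP i j) (H i j) (H j i); rewrite // xij ltxx => // _.
Qed.

(** Density and absence of end points, for finite sets, either of which may be empty. By induction
    on [A]: the separating value is raised whenever the new element is not below it. *)
Lemma between_seqs (R : realFieldType) (A B : seq R) :
  {in A & B, forall a b, a < b} -> exists t, {in A, forall a, a < t} /\ {in B, forall b, t < b}.
Proof.
elim: A => [|a A IH] AB.
  elim: B {AB} => [|b B [t [_ tB]]]; first by exists 0.
  exists (Num.min t (b - 1)); split => // c; rewrite inE => /predU1P[->|/tB tc].
    by rewrite gt_min; apply/orP; right; lra.
  by rewrite gt_min tc.
have [a' b' /= a'A|t [At tB]] := IH; first by apply: AB; rewrite ?inE ?a'A ?orbT.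
have [ta|at_] := ltP a t.
  exists t; split => // c; rewrite inE => /predU1P[->//|]; exact: At.
(* Here [t <= a], so any [s] above [a] is also above the rest of [A]; midpoints keep it below
   [B]. *)
have [s [as_ sB]] : exists s, a < s /\ {in B, forall b, s < b}.
  have : {in B, forall b, a < b} by move=> b; apply: AB; rewrite inE eqxx.
  elim: {IH AB tB} B => [|b B IH] aB; first by exists (a + 1); split => //; lra.
  have [|s [as_ sB]] := IH; first by move=> c cB; apply: aB; rewrite inE cB orbT.
  have ab : a < b by apply: aB; rewrite inE eqxx.
  exists (Num.min s ((a + b) / 2)); split; first by rewrite lt_min as_/=; lra.
  move=> c; rewrite inE => /predU1P[->|/sB sc]; rewrite gt_min.
    by apply/orP; right; lra.
  by rewrite sc.
exists s; split => // c; rewrite inE => /predU1P[->//|/At ct].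
by rewrite (lt_trans ct)// (le_lt_trans at_).
Qed.

(* [q] is the position of [tau] that [x] does not prescribe. *)
Lemma pattern_extension (R : realFieldType) n (tau : 'S_n.+1) (q : 'I_n.+1)
    (x : 'I_n -> R) (a b : R) :
  a < b -> injective x -> (forall i, a < x i < b) ->
  Pi x = Pi (fun i => tau (lift q i)) ->
  exists2 t, a < t < b & forall y : 'I_n.+1 -> R, y q = t ->
    (forall i, y (lift q i) = x i) -> forall i j, (tau i < tau j)%N = (y i < y j).
Proof.
move=> ab xI xab Pix.
have tI : injective (fun i => tau (lift q i)).
  by move=> i j /perm_inj; apply: lift_inj.
have xt i j : (tau (lift q i) < tau (lift q j))%N = (x i < x j).
  by rewrite -(PiP xI) Pix PiP.
have tq i : tau (lift q i) != tau q :> nat.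
  by apply/eqP => /ord_inj/perm_inj; apply/eqP; rewrite eq_sym neq_lift.
(* Separating [A] from [B] places [t] at the rank of [tau q] among the values of [x]; adding [a] and
   [b] to the lists also keeps it in the interval. *)
pose A := a :: [seq x i | i <- enum 'I_n & (tau (lift q i) < tau q)%N].
pose B := b :: [seq x i | i <- enum 'I_n & (tau q < tau (lift q i))%N].
have [|t [At tB]] := @between_seqs R A B.
  move=> c d; rewrite !inE => /predU1P[->|/mapP[i]]; last rewrite mem_filter => /andP[iq _] ->;
  move=> /predU1P[->//|/mapP[j]]; rewrite ?mem_filter.
  - by move=> _ ->; case/andP: (xab j).
  - by case/andP: (xab i).
  - by move=> /andP[qj _] ->; rewrite -xt; exact: ltn_trans qj.
have lo i : (tau (lift q i) < tau q)%N -> x i < t.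
  by move=> h; apply: At; rewrite inE map_f ?orbT// mem_filter h mem_enum.
have hi i : (tau q < tau (lift q i))%N -> t < x i.
  by move=> h; apply: tB; rewrite inE map_f ?orbT// mem_filter h mem_enum.
exists t; first by rewrite At ?tB// inE eqxx.
move=> y yq yx i j.
case: (unliftP q i) => [i'|] ->; case: (unliftP q j) => [j'|] ->;
  rewrite ?yx ?yq ?ltxx ?ltnn//.
- case: (ltngtP (tau (lift q i')) (tau q)) (tq i') => // [/lo -> //|/hi h _].
  by apply/esym/negbTE; rewrite -leNgt ltW.
- case: (ltngtP (tau (lift q j')) (tau q)) (tq j') => // [/lo h _|/hi -> //].
  by apply/esym/negbTE; rewrite -leNgt ltW.
Qed.

End order_patterns.

(** * Words with allowed windows, and bridges between two windows *)

Section words.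
Context (R : realType) (m : nat) (S : {set 'S_m.+1}).
Implicit Types (u v w : seq R) (a b : R).

(* Positions beyond the end of [u] read as [0]. *)
Definition window p u i : p.-tuple R := [tuple nth 0 u (i + j) | j < p].

Definition avoids (v : m.+1.-tuple R) := uniq v && (Pi (tnth v) \notin S).

Definition good u := forall i, (i + m < size u)%N -> avoids (window m.+1 u i).

Definition inside a b u := all (fun t => a < t < b) u.

Lemma chi_avoids (v : m.+1.-tuple R) : chi S v = (avoids v)%:R.
Proof. by rewrite /chi /avoids; case: uniq => //=; case: (_ \in S). Qed.

Lemma nth_window p u i j : (j < p)%N -> nth 0 (window p u i) j = nth 0 u (i + j).
Proof. by move=> jp; rewrite -(tnth_nth 0 _ (Ordinal jp)) tnth_mktuple. Qed.

Lemma eq_window p u i v i' :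
  (forall j, (j < p)%N -> nth 0 u (i + j) = nth 0 v (i' + j)) ->
  window p u i = window p v i'.
Proof. by move=> uv; apply: eq_from_tnth => j; rewrite !tnth_mktuple uv. Qed.

Lemma window_id p (v : p.-tuple R) w : window p (v ++ w) 0 = v.
Proof.
apply: eq_from_tnth => j; rewrite tnth_mktuple add0n nth_cat size_tuple ltn_ord.
by rewrite -tnth_nth.
Qed.

Lemma avoids_order (v v' : m.+1.-tuple R) :
  (forall i j, (tnth v i < tnth v j) = (tnth v' i < tnth v' j)) ->
  avoids v -> avoids v'.
Proof.
move=> vv' /andP[/tuple_uniqP vI vS]; rewrite /avoids -(eq_Pi vv') vS andbT.
by apply/tuple_uniqP; exact: same_order_inj vv' vI.
Qed.

Lemma good_short u : (size u <= m)%N -> good u.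
Proof. by move=> um i; lia. Qed.

Lemma good_tuple (v : m.+1.-tuple R) : avoids v -> good v.
Proof.
move=> vS i; rewrite size_tuple => im; have -> : i = 0%N by lia.
by have := window_id v [::]; rewrite cats0 => ->.
Qed.

(* A window of length [m.+1] cannot meet both [u] and [w]. *)
Lemma good_glue u v w : size v = m ->
  good (u ++ v) -> good (v ++ w) -> good (u ++ v ++ w).
Proof.
move=> vm uv vw i; rewrite !size_cat vm => iw.
have [iu|ui] := ltnP i (size u).
  rewrite (@eq_window _ _ i (u ++ v) i); first by apply: uv; rewrite size_cat vm; lia.
  move=> j jm; have ij : (i + j < size u + m)%N by lia.
  by rewrite catA [LHS]nth_cat size_cat vm ij.
rewrite (@eq_window _ _ i (v ++ w) (i - size u)).
  by apply: vw; rewrite size_cat vm; lia.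
move=> j jm; have uij : (size u <= i + j)%N by lia.
by rewrite [LHS]nth_cat ltnNge uij /= addnBAC.
Qed.

Lemma good_increasing u : increasing_perm m.+1 \notin S -> sorted <%R u -> good u.
Proof.
move=> iS us i iu.
have H (j k : 'I_m.+1) : (j < k)%N -> tnth (window m.+1 u i) j < tnth (window m.+1 u i) k.
  move=> jk; rewrite !tnth_mktuple; have km := ltn_ord k.
  have [ij ik ijk] : [/\ i + j < size u, i + k < size u & i + j < i + k]%N by split; lia.
  exact: (sorted_ltn_nth lt_trans 0 us _ _ ij ik ijk).
rewrite /avoids (Pi_increasing H) iS andbT; apply/tuple_uniqP => j k jk.
by apply: ord_inj; case: (ltngtP j k) => // /H; rewrite jk ltxx.
Qed.

Lemma good_decreasing u : decreasing_perm m.+1 \notin S -> sorted >%R u -> good u.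
Proof.
move=> iS us i iu.
have H (j k : 'I_m.+1) : (j < k)%N -> tnth (window m.+1 u i) k < tnth (window m.+1 u i) j.
  move=> jk; rewrite !tnth_mktuple; have km := ltn_ord k.
  have [ij ik ijk] : [/\ i + j < size u, i + k < size u & i + j < i + k]%N by split; lia.
  exact: (sorted_ltn_nth (rev_trans lt_trans) 0 us _ _ ij ik ijk).
rewrite /avoids (Pi_decreasing H) iS andbT; apply/tuple_uniqP => j k jk.
by apply: ord_inj; case: (ltngtP j k) => // /H; rewrite jk ltxx.
Qed.

Lemma sorted_Pi_increasing p (v : p.-tuple R) : uniq v ->
  Pi (tnth v) = increasing_perm p -> sorted <%R v.
Proof.
move=> /tuple_uniqP vI Piv; apply/(sortedP 0) => i; rewrite size_tuple => ip.
have := PiP vI (Ordinal (ltnW ip)) (Ordinal ip).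
by rewrite Piv !perm1/= ltnSn !(tnth_nth 0)/= => <-.
Qed.

Lemma sorted_Pi_decreasing p (v : p.-tuple R) : uniq v ->
  Pi (tnth v) = decreasing_perm p -> sorted >%R v.
Proof.
move=> /tuple_uniqP vI Piv; apply/(sortedP 0) => i; rewrite size_tuple => ip.
have := PiP vI (Ordinal ip) (Ordinal (ltnW ip)).
by rewrite Piv !permE/= !(tnth_nth 0)/= => <-; lia.
Qed.

Lemma edge_extension (tau : 'S_m.+1) (z : m.+1.-tuple R) : tau \notin S ->
  (forall i j, (tau i < tau j)%N = (tnth z i < tnth z j)) -> avoids z.
Proof.
move=> tS tz; have zI : injective (tnth z).
  exact: (same_order_inj (x := tau) (y := tnth z) tz (@perm_inj _ tau)).
by rewrite /avoids -(Pi_unique zI tz) tS andbT; apply/tuple_uniqP.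
Qed.

(** The permutation [tau] behind the edge prescribes the rank of the new last letter [t]; [c] is the
    letter that leaves the window. *)
Lemma forward_step a b (y : m.-tuple R) q : a < b -> uniq y -> inside a b y ->
  edge S (Pi (tnth y)) q ->
  exists t c (y' : m.-tuple R), [/\ rcons y t = c :: y', a < t < b, uniq y',
    Pi (tnth y') = q & good (rcons y t)].
Proof.
move=> ab /tuple_uniqP yI /allP yab /existsP[tau /and3P[tS /eqP Py /eqP Pq]].
have yab' i : a < tnth y i < b by apply: yab; exact: mem_tnth.
(* Omitting the last position is [lift ord_max], the form that [pattern_extension] needs. *)
have wl (i : 'I_m) : widen_ord (leqnSn m) i = lift ord_max i.
  by apply: val_inj; rewrite /= /bump leqNgt ltn_ord.
have [|t tab tz] := pattern_extension (tau := tau) (q := ord_max) ab yI yab'.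
  by rewrite -Py; apply: eq_Pi => i j; rewrite !wl.
pose z := [tuple of rcons y t].
have {}tz : forall i j, (tau i < tau j)%N = (tnth z i < tnth z j).
  apply: tz => [|i]; rewrite !(tnth_nth 0) ?lift_max nth_rcons size_tuple ?ltnn ?eqxx//.
  by rewrite ltn_ord.
have za := edge_extension tS tz.
exists t, (thead z), [tuple of behead z]; split => //.
- by rewrite -[LHS]/(val z) {1}(tuple_eta z).
- by case/andP: za => + _; rewrite {1}(tuple_eta z) => /andP[].
- rewrite -Pq; apply: eq_Pi => i j; rewrite ltEord/= tz; congr (_ < _);
  by rewrite [RHS](tnth_nth 0) [LHS](tnth_nth 0) nth_behead.
- exact: (good_tuple za).
Qed.

(** Mirror image of [forward_step]: [tau] now prescribes the rank of a new first letter. *)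
Lemma backward_step a b (x : m.-tuple R) p : a < b -> uniq x -> inside a b x ->
  edge S p (Pi (tnth x)) ->
  exists t c (x' : m.-tuple R), [/\ t :: x = rcons x' c, a < t < b, uniq x',
    Pi (tnth x') = p & good (t :: x)].
Proof.
move=> ab /tuple_uniqP xI /allP xab /existsP[tau /and3P[tS /eqP Pp /eqP Px]].
have xab' i : a < tnth x i < b by apply: xab; exact: mem_tnth.
have [|t tab tz] := pattern_extension (tau := tau) (q := ord0) ab xI xab'.
  by rewrite -Px.
pose z := [tuple of t :: x].
have {}tz : forall i j, (tau i < tau j)%N = (tnth z i < tnth z j).
  by apply: tz => [|i]; rewrite !(tnth_nth 0).
have za := edge_extension tS tz.
exists t, (last t x), [tuple of belast t x]; split => //.
- exact: lastI.
- by case/andP: za => + _; rewrite /z/= -/(uniq (t :: x)) lastI rcons_uniq => /andP[].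
- rewrite -Pp; apply: eq_Pi => i j; rewrite ltEord/= tz; congr (_ < _);
  rewrite [RHS](tnth_nth 0) [LHS](tnth_nth 0)/= -[_ :: _]/(t :: val x) lastI;
  by rewrite nth_rcons size_belast size_tuple ltn_ord.
- exact: (good_tuple za).
Qed.

(** One letter is appended per edge. Consecutive steps share a window of [m] letters, so [good_glue]
    joins them. *)
Lemma forward_path a b (y : m.-tuple R) s : a < b -> uniq y -> inside a b y ->
  path (edge S) (Pi (tnth y)) s ->
  exists w u (v : m.-tuple R), [/\ size w = size s, inside a b w, y ++ w = u ++ v,
    good (y ++ w) & uniq v /\ Pi (tnth v) = last (Pi (tnth y)) s].
Proof.
move=> ab; elim: s y => [|q s IH] y yu yab /=.
  by exists [::], [::], y; split; rewrite ?cats0//; apply: good_short; rewrite size_tuple.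
move=> /andP[yq qs].
have [t [c [y' [yt tab y'u Py' gt]]]] := forward_step ab yu yab yq.
have y'ab : inside a b y'.
  have : inside a b (rcons y t) by rewrite /inside all_rcons tab.
  by rewrite yt => /andP[].
have [|w [u [v [ws wab E gw [vu Pv]]]]] := IH y' y'u y'ab; first by rewrite Py'.
exists (t :: w), (c :: u), v.
have E' : y ++ t :: w = [:: c] ++ y' ++ w by rewrite -cat_rcons yt.
split => //=; rewrite ?ws ?tab//; first by rewrite E' E.
  by rewrite E'; apply: good_glue; rewrite ?size_tuple//= -yt.
by rewrite Pv Py'.
Qed.

Lemma backward_path a b (x : m.-tuple R) p s : a < b -> uniq x -> inside a b x ->
  path (edge S) p s -> last p s = Pi (tnth x) ->
  exists w u (v : m.-tuple R), [/\ size w = size s, inside a b w, w ++ x = v ++ u,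
    good (w ++ x) & uniq v /\ Pi (tnth v) = p].
Proof.
(* Letters are put in front of [x], so the last edge of the path is used first. *)
move=> ab; elim/last_ind: s x => [|s q IH] x xu xab /=.
  move=> _ ->; exists [::], [::], x.
  by split; rewrite ?cats0//; apply: good_short; rewrite size_tuple.
rewrite rcons_path last_rcons => /andP[ps sq] qx; rewrite {}qx in sq.
have [t [c [x' [tx tab x'u Px' gt]]]] := backward_step ab xu xab sq.
have x'ab : inside a b x'.
  have : inside a b (t :: x) by rewrite /= tab.
  by rewrite tx /inside all_rcons => /andP[].
have [w [u [v [ws wab E gw [vu Pv]]]]] := IH x' x'u x'ab ps (esym Px').
have E' : rcons w t ++ x = w ++ x' ++ [:: c] by rewrite cat_rcons tx cats1.
exists (rcons w t), (rcons u c), v; split => //; rewrite ?size_rcons ?ws//.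
- by rewrite /inside all_rcons tab.
- by rewrite E' catA E cats1 rcons_cat.
by rewrite E'; apply: good_glue; rewrite ?size_tuple// cats1 -tx.
Qed.

Lemma sorted_inside n a b : a < b -> exists u, [/\ size u = n, sorted <%R u & inside a b u].
Proof.
elim: n a => [|n IH] a ab; first by exists [::].
have ab2 : (a + b) / 2 < b by lra.
have [u [us uo uab]] := IH _ ab2.
exists ((a + b) / 2 :: u); split => /=; rewrite ?us//.
  by rewrite path_min_sorted//; apply: sub_all uab => t /andP[].
by apply/andP; split; [lra|apply: sub_all uab => t; lra].
Qed.

(** The bound is independent of the end points, so that a filler of variable length can give all
    bridges the same length. *)
Lemma short_path (V : finType) (e : rel V) p q : connect e p q ->
  exists s, [/\ path e p s, last p s = q & (size s <= #|V|)%N].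
Proof.
move=> /connectP[s /shortenP[s' ps' us' _] ->]; exists s'; split => //.
by apply: (leq_trans (leqnSn _)); rewrite -[_.+1]/(size (p :: s')) -(card_uniqP us') max_card.
Qed.

Lemma sorted_cat (r : rel R) u v : transitive r ->
  sorted r u -> sorted r v -> allrel r u v -> sorted r (u ++ v).
Proof. by move=> tr; rewrite !sorted_pairwise// pairwise_cat => -> -> ->. Qed.

(** The bridge is [w1 ++ dt ++ w3 ++ e ++ w5]. Here [z ++ w1] ends in the decreasing window [v1],
    [dt] continues the descent, [dt ++ w3] ends in the increasing window [c], [e] climbs, and
    [w5 ++ x] begins with the increasing window [b]. *)
Lemma good_bridge (x z : m.-tuple R) :
  strongly_connected (edge S) ->
  increasing_perm m.+1 \notin S -> decreasing_perm m.+1 \notin S ->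
  uniq x -> uniq z -> inside 0 1 x -> inside 0 1 z ->
  exists w, [/\ size w = (3 * #|{perm 'I_m}| + m)%N, inside 0 1 w & good (z ++ w ++ x)].
Proof.
(* [n1], [n3], [n5] are the lengths of the three paths, and the filler [e] takes what is left of
   [3 * M]; the bounds by [M] make the truncated subtraction exact. *)
have size_arith M n1 n3 n5 n : (n1 <= M -> n3 <= M -> n5 <= M ->
    n1 + (n + (n3 + (3 * M - (n1 + n3 + n5) + n5))) = 3 * M + n)%N by clear; lia.
move=> conn Si Sd xu zu x01 z01.
(* The two ends come first, since the levels below are chosen from the letters of [b] and [v1]. *)
have [s5 [ps5 ls5 ss5]] := short_path (conn (increasing_perm m) (Pi (tnth x))).
have [w5 [u5 [b [w5s w501 Eb gb [bu Pb]]]]] := backward_path ltr01 xu x01 ps5 ls5.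
have [s1 [ps1 ls1 ss1]] := short_path (conn (Pi (tnth z)) (decreasing_perm m)).
have [w1 [u1 [v1 [w1s w101 E1 g1 [v1u Pv1]]]]] := forward_path ltr01 zu z01 ps1.
rewrite ls1 in Pv1.
have b01 : inside 0 1 b.
  have : inside 0 1 (w5 ++ x) by rewrite /inside all_cat; apply/andP.
  by rewrite Eb /inside all_cat => /andP[].
have v101 : inside 0 1 v1.
  have : inside 0 1 (z ++ w1) by rewrite /inside all_cat; apply/andP.
  by rewrite E1 /inside all_cat => /andP[].
(* The level [beta] lies below all of [b], and [dl] below both [beta] and all of [v1]. *)
have [|beta [b0 bb]] := @between_seqs R [:: 0] (1 :: b).
  move=> i j; rewrite !inE => /eqP-> /predU1P[->//|/(allP b01)]; exact: ltr01 || by case/andP.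
have [|dl [d0 dv]] := @between_seqs R [:: 0] (beta :: v1).
  move=> i j; rewrite !inE => /eqP-> /predU1P[->|/(allP v101)]; last by case/andP.
  by apply: b0; rewrite inE.
have {}b0 : 0 < beta by apply: b0; rewrite inE.
have {}d0 : 0 < dl by apply: d0; rewrite inE.
have b1 : beta < 1 by apply: bb; rewrite inE eqxx.
have db : dl < beta by apply: dv; rewrite inE eqxx.
(* Reversed, [d] is a decreasing window under [dl], so [v1 ++ dt] is decreasing and the path that
   follows can stay below [beta]. *)
have [d [ds dsort d0d]] := sorted_inside m d0.
pose dt := tcast ds (rev_tuple (in_tuple d)).
have dtE : dt = rev d :> seq R by rewrite val_tcast.
have dtd : sorted >%R dt by rewrite dtE rev_sorted.
have dtin : inside 0 dl dt by rewrite dtE /inside all_rev.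
have g2 : good (v1 ++ dt).
  apply: good_decreasing => //; apply: sorted_cat => //; first exact: rev_trans lt_trans.
    exact: sorted_Pi_decreasing.
  apply/allrelP => i j iv /(allP dtin)/andP[_ jd].
  by apply: (lt_trans jd); apply: dv; rewrite inE iv orbT.
have dtu : uniq dt by apply: (sorted_uniq (rev_trans lt_trans) _ dtd) => i; exact: ltxx.
have Pdt : Pi (tnth dt) = decreasing_perm m.
  apply: Pi_decreasing => i j ij; rewrite !(tnth_nth 0).
  by apply: (sorted_ltn_nth (rev_trans lt_trans) 0 dtd); rewrite ?inE ?size_tuple.
have [s3 [ps3 ls3 ss3]] := short_path (conn (Pi (tnth dt)) (increasing_perm m)).
have dtb : inside 0 beta dt by apply: sub_all dtin => t; lra.
have [w3 [u3 [c [w3s w3b E3 g3 [cu Pc]]]]] := forward_path b0 dtu dtb ps3.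
rewrite ls3 in Pc.
have cb : inside 0 beta c.
  have : inside 0 beta (dt ++ w3) by rewrite /inside all_cat; apply/andP.
  by rewrite E3 /inside all_cat => /andP[].
(* With [ga] above all of [c], a filler [e] between [ga] and [beta] makes [c ++ e ++ b] increasing,
   whatever its length. *)
have [|ga [cg gb_]] := @between_seqs R (0 :: c) [:: beta].
  by move=> i j; rewrite !inE => /predU1P[->|/(allP cb)/andP[_ +]] /eqP ->.
have {gb_} gb_ : ga < beta by apply: gb_; rewrite inE.
have g0 : 0 < ga by apply: cg; rewrite inE eqxx.
have [e [es esort ein]] :=
  sorted_inside (3 * #|{perm 'I_m}| - (size w1 + size w3 + size w5)) gb_.
have g4 : good (c ++ e ++ b).
  apply: good_increasing => //; apply: sorted_cat; first exact: lt_trans.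
  - exact: sorted_Pi_increasing.
  - apply: sorted_cat => //; [exact: lt_trans|exact: sorted_Pi_increasing|].
    apply/allrelP => i j /(allP ein)/andP[_ ib] jb.
    by apply: (lt_trans ib); apply: bb; rewrite inE jb orbT.
  apply/allrelP => i j ic; rewrite mem_cat => /orP[/(allP ein)/andP[+ _]|jb].
    by apply: lt_trans; apply: cg; rewrite inE ic orbT.
  apply: (@lt_trans _ _ beta); first by case/andP: (allP cb _ ic).
  by apply: bb; rewrite inE jb orbT.
exists (w1 ++ dt ++ w3 ++ e ++ w5); split.
- rewrite !size_cat (size_tuple dt) es w1s w3s w5s; apply: size_arith;
    [exact: ss1|exact: ss3|exact: ss5].
- have beta1 a u : 0 <= a -> inside a beta u -> inside 0 1 u.
    by move=> a0; apply: sub_all => t; lra.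
  rewrite /inside !all_cat; apply/and5P; split => //; apply: beta1;
    [|exact: dtb| |exact: w3b| |exact: ein];
  by rewrite // ltW.
(* The pieces are glued along the overlaps [v1], [dt], [c] and [b], in this order. *)
have h1 : good ((z ++ w1) ++ dt).
  by rewrite E1 -catA; apply: good_glue; rewrite ?size_tuple// -E1.
have h2 : good ((z ++ w1) ++ u3 ++ c).
  by rewrite -E3; apply: good_glue; rewrite ?size_tuple.
have h3 : good (((z ++ w1) ++ u3) ++ c ++ e ++ b).
  by apply: good_glue; rewrite ?size_tuple// -catA.
have h4 : good ((((z ++ w1) ++ u3) ++ c ++ e) ++ b ++ u5).
  by apply: good_glue; rewrite ?size_tuple// -?Eb// -!catA; rewrite -!catA in h3.
move: h4; rewrite -Eb -!catA => h4.
rewrite (_ : z ++ _ = z ++ w1 ++ u3 ++ c ++ e ++ w5 ++ x)//.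
by rewrite (catA u3) -E3 -!catA.
Qed.

End words.

(** * Positivity of integrals over the unit interval *)

Section uniform_measure.
Context (R : realType).
Local Notation T := (measurableTypeR R).
Local Notation U := (uniform_prob (@ltr01 R)).

Lemma uniform_prob_itv (c e : R) : 0 <= c -> c < e -> e <= 1 -> U `]c, e[%classic = (e - c)%:E.
Proof.
move=> c0 ce e1; rewrite /uniform_prob (eq_integral (cst 1%E)); last first.
  move=> t; rewrite inE/= in_itv/= => /andP[ct te]; rewrite /uniform_pdf ifT ?subr0 ?invr1//.
  by rewrite (ltW (le_lt_trans c0 ct)) (ltW (lt_le_trans te e1)).
rewrite integral_cst// mul1e.
by have := lebesgue_measure_itv `]c, e[; rewrite /= lte_fin ce; apply.
Qed.

Lemma uniform_prob_set1 (c : R) : U [set c]%classic = 0%E.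
Proof. by rewrite /uniform_prob integral_set1. Qed.

Lemma ae_uniform_prob_itv : {ae U, forall t : T, 0 < (t : R) < 1}.
Proof.
exists (~` `]0, 1[)%classic; split.
- by apply: measurableC; exact: measurable_itv.
- have m01 : measurable (`]0, 1[%classic : set T) by exact: measurable_itv.
  transitivity (1%E - U `]0%R, 1%R[%classic)%E; first exact: probability_setC.
  by rewrite uniform_prob_itv// subr0 subee.
- by move=> t /=; rewrite in_itv.
Qed.

(** If the integral were zero, [phi] would vanish almost everywhere, yet it is positive on an
    interval of positive measure around [t0]. *)
Lemma uniform_integral_gt0 (phi : T -> \bar R) (t0 : R) :
  measurable_fun setT phi -> (forall t, 0 <= phi t)%E -> 0 < t0 < 1 ->
  (\forall t \near t0, (0 < phi t)%E) -> (0 < \int[U]_t phi t)%E.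
Proof.
move=> mphi phi0 /andP[t00 t01] nphi.
have : \forall t \near t0, (0 < phi t)%E /\ (0 < t < 1).
  near=> t; split; first by near: t.
  by apply/andP; split; near: t; [exact: lt_nbhsr|exact: lt_nbhsl].
move=> /nbhs_ballP[e /= e0 He].
rewrite lt0e integral_ge0 ?andbT//; apply/eqP => i0.
have : (\int[U]_t `|phi t| = 0)%E by under eq_integral do rewrite gee0_abs//.
move/ae_eq_integral_abs => /(_ measurableT mphi) [N [mN N0 NN]].
(* Halving the radius puts the end points inside the ball, hence inside the unit interval, where the
   uniform measure is length. *)
have sub : (`]t0 - e / 2, t0 + e / 2[%classic `<=` N)%classic.
  move=> t /=; rewrite in_itv/= => /andP[a b]; apply: NN => /= /(_ I) pt.
  have [|] := He t; first by rewrite /ball/= ltr_norml; lra.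
  by rewrite pt ltxx.
have : (U `](t0 - e / 2)%R, (t0 + e / 2)%R[%classic <= U N)%E.
  by apply: le_measure => //; rewrite inE//; exact: measurable_itv.
have /He[_ /andP[h1 _]] : ball t0 e (t0 - e / 2) by rewrite /ball/= ltr_norml; lra.
have /He[_ /andP[_ h2]] : ball t0 e (t0 + e / 2) by rewrite /ball/= ltr_norml; lra.
rewrite N0 uniform_prob_itv; [|lra|lra|lra].
by rewrite lee_fin; lra.
Unshelve. all: by end_near.
Qed.

End uniform_measure.

(** * Almost every point of the cube is interior and has distinct coordinates *)

Section cube_generic.
Context (R : realType).
Local Notation T := (measurableTypeR R).
Local Notation U := (uniform_prob (@ltr01 R)).
Local Notation P := (cube_measure R).

(** Tonelli for the indicator of the complement of [Q], whose sections are null for almost every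
    first coordinate. *)
Lemma ae_cubeS n (Q : set (n.+1.-tuple T)) : measurable Q ->
  {ae U, forall t, {ae P n, forall y, Q (tuple_cons (t, y))}} ->
  {ae P n.+1, forall x, Q x}.
Proof.
move=> mQ aeQ; have mQc : measurable (~` Q)%classic by exact: measurableC.
exists (~` Q)%classic; split => //.
have mI : measurable_fun setT (fun x : n.+1.-tuple T => (\1_(~` Q)%classic x)%:E : \bar R).
  by apply/measurable_EFinP; exact: measurable_indic.
transitivity (\int[P n.+1]_x (\1_(~` Q)%classic x)%:E)%E.
  by rewrite integral_indic// setIT.
have I0 (x : n.+1.-tuple T) : (0 <= (\1_(~` Q)%classic x)%:E :> \bar R)%E.
  by rewrite lee_fin.
rewrite ge0_integral_cubeS//.
rewrite -[RHS](integral0 U setT); apply: ae_eq_integral => //.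
  apply: (measurable_fun_fubini_tonelli_F (m2 := P n)
    (fun z => (\1_(~` Q)%classic (tuple_cons z))%:E)) => //.
  exact: (measurableT_comp mI (@measurable_tuple_cons R n)).
apply: filterS aeQ => t aet _ /=.
rewrite -[RHS](integral0 (P n) setT); apply: ae_eq_integral => //.
  apply: (measurableT_comp mI).
  exact: (measurableT_comp (@measurable_tuple_cons R n) (measurable_pair1 t)).
by apply: filterS aet => y Qy _; rewrite indicE/= memNset.
Qed.

Lemma measurable_tnth_forall n (B : set T) : measurable B ->
  measurable [set x : n.-tuple T | forall i, B (tnth x i)].
Proof.
move=> mB.
rewrite (_ : [set _ | _]%classic =
    (\bigcap_(i in [set: 'I_n]) [set x : n.-tuple T | B (tnth x i)])%classic).
  apply: fin_bigcap_measurable => // i _; rewrite -[X in measurable X]setTI.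
  exact: (@measurable_tnth _ T n i measurableT B mB).
by apply/seteqP; split=> [x xB i _|x xB i]; [exact: xB|exact: (xB i I)].
Qed.

Lemma ae_cube_notin n (t : R) : {ae P n, forall y : n.-tuple T, t \notin (y : seq R)}.
Proof.
elim: n => [|n IH]; first by apply: aeW => y; rewrite tuple0.
apply: (@ae_cubeS n [set y : n.+1.-tuple T | t \notin (y : seq R)]%classic).
  rewrite (_ : [set _ | _]%classic =
      [set y : n.+1.-tuple T | forall i, (~` [set t])%classic (tnth y i)]%classic).
    by apply: measurable_tnth_forall; exact: measurableC.
  apply/seteqP; split=> [y /= ty i yt|y /= yt].
    by move/negP: ty; apply; rewrite -yt mem_tnth.
  by apply/negP => /tnthP[i ti]; apply: (yt i).
exists [set t]%classic; split; [exact: measurable_set1|exact: uniform_prob_set1|].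
move=> s /= nH; apply: contra_notP nH => st.
apply: filterS IH => y ty /=; rewrite inE negb_or ty andbT.
by apply/eqP => ts; apply: st.
Qed.

Lemma ae_cube_generic n :
  {ae P n, forall x : n.-tuple T, inside 0 1 (x : seq R) /\ uniq (x : seq R)}.
Proof.
elim: n => [|n IH]; first by apply: aeW => y; rewrite tuple0.
apply: (@ae_cubeS n [set x : n.+1.-tuple T | inside 0 1 (x : seq R) /\ uniq (x : seq R)]%classic).
  (* For the empty set of forbidden patterns, [chi] is 1 exactly on the words without repetition, so
     [measurable_chi] makes that condition measurable. *)
  rewrite (_ : [set _ | _]%classic =
     ([set y : n.+1.-tuple T | forall i, (`]0%R, 1%R[%classic : set T) (tnth y i)] `&`
      [set y : n.+1.-tuple T | chi (R:=R) finset.set0 y = 1%R])%classic).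
    apply: measurableI; first by apply: measurable_tnth_forall; exact: measurable_itv.
    rewrite -[X in measurable X]setTI.
    exact: (measurable_chi (R := R) (n := n.+1) finset.set0 measurableT (measurable_set1 1)).
  apply/seteqP; split=> y /= [y01 yu]; split.
  - by move=> i; rewrite /= in_itv/=; apply: (allP y01); exact: mem_tnth.
  - by rewrite /chi yu/= finset.in_set0.
  - by apply/allP => t /tnthP[i ->]; have := y01 i; rewrite /= in_itv.
  - by apply/negPn/negP => yn; move: yu; rewrite /chi yn => /esym/eqP; rewrite oner_eq0.
apply: filterS (ae_uniform_prob_itv R) => t t01.
apply: filterS2 IH (ae_cube_notin n t) => y [y01 yu] ty /=.
by rewrite ty yu t01 y01.
Qed.

End cube_generic.

(** * Measurability of concatenations and Tonelli for products of cubes *)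

Section iterated_integral.
Context (R : realType).
Local Notation T := (measurableTypeR R).
Local Notation U := (uniform_prob (@ltr01 R)).
Local Notation P := (cube_measure R).

(** Stated letter by letter, so that concatenations and windows are handled as plain lists, without
    casts between tuple lengths. *)
Definition measurable_seq d (X : measurableType d) (phi : X -> seq R) :=
  forall i, measurable_fun setT (fun a => nth 0 (phi a) i : T).

Lemma measurable_seq_cst d (X : measurableType d) u :
  measurable_seq (fun _ : X => u).
Proof. by move=> i; exact: measurable_cst. Qed.

Lemma measurable_seq_tuple d (X : measurableType d) n (phi : X -> n.-tuple T) :
  measurable_fun setT phi -> measurable_seq phi.
Proof.
move=> mphi i; have [ni|ni] := ltnP i n.
  have := (measurable_fun_tnthP phi).1 mphi (Ordinal ni).
  by apply: eq_measurable_fun => a _ /=; rewrite (tnth_nth 0).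
rewrite (_ : (fun a => _) = cst 0); first exact: measurable_cst.
by apply/funext => a; rewrite nth_default// size_tuple.
Qed.

Lemma measurable_seq_cat d (X : measurableType d) n (phi psi : X -> seq R) :
  (forall a, size (phi a) = n) -> measurable_seq phi -> measurable_seq psi ->
  measurable_seq (fun a => phi a ++ psi a).
Proof.
move=> sn mphi mpsi i; have [ni|ni] := ltnP i n.
  by apply: eq_measurable_fun (mphi i) => a _; rewrite nth_cat sn ni.
by apply: eq_measurable_fun (mpsi (i - n)%N) => a _; rewrite nth_cat sn ltnNge ni.
Qed.

Lemma measurable_window d (X : measurableType d) (phi : X -> seq R) p i :
  measurable_seq phi ->
  measurable_fun setT (fun a => window p (phi a) i : p.-tuple T).
Proof.
move=> mphi; apply/measurable_fun_tnthP => j.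
by apply: eq_measurable_fun (mphi (i + j)%N) => a _ /=; rewrite tnth_mktuple.
Qed.

Lemma measurable_seq_tuple_cat n u :
  measurable_seq (fun y : n.-tuple T => y ++ u).
Proof.
apply: (measurable_seq_cat (n := n)); first by move=> a; rewrite size_tuple.
  by apply: measurable_seq_tuple; exact: measurable_id.
exact: measurable_seq_cst.
Qed.

Lemma measurable_tuple_cat p n :
  measurable_fun setT (fun v : p.-tuple T * n.-tuple T =>
    [tuple of v.1 ++ v.2] : (p + n).-tuple T).
Proof.
apply/measurable_fun_tnthP => i.
have := measurable_seq_cat (fun v : p.-tuple T * n.-tuple T => size_tuple v.1)
  (measurable_seq_tuple measurable_fst) (measurable_seq_tuple measurable_snd) i.
by apply: eq_measurable_fun => v _ /=; rewrite (tnth_nth 0).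
Qed.

Lemma integral_cube_cat p n (F : (p + n).-tuple T -> \bar R) :
  measurable_fun setT F -> (forall y, 0 <= F y)%E ->
  (\int[P (p + n)]_y F y = \int[P p]_z \int[P n]_w F [tuple of z ++ w])%E.
Proof.
elim: p F => [|p IH] F mF F0.
  rewrite [RHS](eq_integral (cst (\int[P n]_w F w)%E)).
    by rewrite integral_cst// [X in (_ * X)%E](probability_setT (P 0)) mule1.
  move=> z _; apply: eq_integral => w _; congr F.
  by apply: val_inj; rewrite /= [z]tuple0.
rewrite (@ge0_integral_cubeS R (p + n))// ge0_integral_cubeS//; last 2 first.
- apply: (measurable_fun_fubini_tonelli_F (m2 := P n)
    (fun v : p.+1.-tuple T * n.-tuple T => F [tuple of v.1 ++ v.2])) => //.
  exact: (measurableT_comp mF (@measurable_tuple_cat p.+1 n)).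
- by move=> z; apply: integral_ge0.
apply: eq_integral => t _; rewrite (IH (fun y => F (tuple_cons (t, y)))).
- by apply: eq_integral => z _; apply: eq_integral => w _; congr F; exact: val_inj.
- apply: (measurableT_comp mF).
  exact: (measurableT_comp (@measurable_tuple_cons R (p + n)) (measurable_pair1 t)).
- by move=> y; exact: F0.
Qed.

End iterated_integral.

(** * The kernel of the iterates and the positivity of its integral *)

Section positive_weight.
Context (R : realType) (m : nat) (S : {set 'S_m.+1}).
Local Notation T := (measurableTypeR R).
Local Notation U := (uniform_prob (@ltr01 R)).
Local Notation P := (cube_measure R).

(** The kernel W of the overview. A word of length [k + m] has exactly [k] windows of length
    [m.+1]. *)
Definition weight k (u : seq R) : R := \prod_(i < k) chi S (window m.+1 u i).

Lemma weight_ge0 k u : 0 <= weight k u.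
Proof. by apply: prodr_ge0 => i _; exact: chi_ge0. Qed.

Lemma weight_eq1 k u : (forall i, (i < k)%N -> avoids S (window m.+1 u i)) ->
  weight k u = 1.
Proof. by move=> ku; apply: big1 => i _; rewrite chi_avoids ku. Qed.

Lemma measurable_weight d (X : measurableType d) (phi : X -> seq R) k :
  measurable_seq phi -> measurable_fun setT (fun a => weight k (phi a)).
Proof.
move=> mphi; apply: measurable_prod => i _.
have mw := @measurable_window R _ _ phi m.+1 i mphi.
exact: (measurableT_comp (f := chi S : m.+1.-tuple T -> R) (measurable_chi S) mw).
Qed.

(** A pattern is fixed by finitely many comparisons. Distinct positions of an allowed window carry
    distinct letters, so these comparisons are strict and survive a small move of one letter. *)
Lemma near_avoids k (u v : seq R) (t0 : R) :
  (forall i, (i < k)%N -> avoids S (window m.+1 (u ++ t0 :: v) i)) ->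
  \forall t \near t0, forall i, (i < k)%N -> avoids S (window m.+1 (u ++ t :: v) i).
Proof.
move=> H.
have E1 t : nth 0 (u ++ t :: v) (size u) = t by rewrite nth_cat ltnn subnn.
have E2 t i : i != size u -> nth 0 (u ++ t :: v) i = nth 0 (u ++ t0 :: v) i.
  rewrite !nth_cat; case: ltngtP => // iu _.
  by case: (i - size u)%N (subn_gt0 (size u) i) => //; rewrite iu.
pose C (q : 'I_k * 'I_m.+1 * 'I_m.+1) (t : R) :=
  let i := q.1.1 in let u' := u ++ t :: v in let u0 := u ++ t0 :: v in
  (nth 0 u0 (i + q.1.2) < nth 0 u0 (i + q.2)) = (nth 0 u' (i + q.1.2) < nth 0 u' (i + q.2)).
have nC q : \forall t \near t0, C q t.
  case: q => -[i j j'].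
  have : (i + j = i + j')%N \/ nth 0 (u ++ t0 :: v) (i + j) != nth 0 (u ++ t0 :: v) (i + j').
    have /andP[/tuple_uniqP wI _] := H i (ltn_ord i).
    have [->|jj'] := eqVneq j j'; [by left|right].
    by apply: contra_neq jj' => e; apply: wI; rewrite !tnth_mktuple.
  suff : (i + j = i + j')%N \/ nth 0 (u ++ t0 :: v) (i + j) != nth 0 (u ++ t0 :: v) (i + j') ->
     \forall t \near t0,
    (nth 0 (u ++ t0 :: v) (i + j) < nth 0 (u ++ t0 :: v) (i + j')) =
    (nth 0 (u ++ t :: v) (i + j) < nth 0 (u ++ t :: v) (i + j')).
    by move=> h /h.
  move: (i + j)%N (i + j')%N => {j j'} {}i j [->|]; first by near=> t; rewrite !ltxx.
  have [->|iu] := eqVneq i (size u); have [->|ju] := eqVneq j (size u).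
  - by rewrite eqxx.
  - rewrite E1 neq_lt => /orP[h|h].
      by apply: filterS (lt_nbhsl h) => t th; rewrite !E1 (E2 t)// h th.
    apply: filterS (lt_nbhsr h) => t th.
    by rewrite !E1 (E2 t)// !ltNge (ltW h) (ltW th).
  - rewrite E1 neq_lt => /orP[h|h].
      by apply: filterS (lt_nbhsr h) => t th; rewrite !E1 (E2 t)// h th.
    apply: filterS (lt_nbhsl h) => t th.
    by rewrite !E1 (E2 t)// !ltNge (ltW h) (ltW th).
  - by move=> _; near=> t; rewrite (E2 t i)// (E2 t j).
have := @filter_forall _ _ C (nbhs t0) (nbhs_filter t0) nC.
apply: filterS => t Ct i ik.
apply: avoids_order (H i ik) => j j'; rewrite !tnth_mktuple.
exact: (Ct (Ordinal ik, j, j')).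
Unshelve. all: by end_near.
Qed.

(** By induction on [n], varying one letter at a time: for [t] near the first letter of [w], the
    rest of [w] is still a witness after the prefix [rcons u t], so the inner integral is positive
    on a neighbourhood. *)
Lemma integral_weight_gt0 k n (u v : seq R) :
  (exists w, [/\ size w = n, inside 0 1 w &
    forall i, (i < k)%N -> avoids S (window m.+1 (u ++ w ++ v) i)]) ->
  (0 < \int[P n]_w (weight k (u ++ w ++ v))%:E)%E.
Proof.
have mW p (s : seq R) : measurable_fun setT (fun w : p.-tuple T => (weight k (s ++ w ++ v))%:E).
  apply/measurable_EFinP; apply: measurable_weight.
  apply: (measurable_seq_cat (n := size s)) => //.
  exact: measurable_seq_tuple_cat.
elim: n u => [|n IH] u [w [ws w01 gw]].
  case: w ws gw {w01} => // _ gw.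
  rewrite (eq_integral (cst 1%E)).
    by rewrite integral_cst// [X in (_ * X)%E](probability_setT (P 0)) mule1 lte01.
  by move=> y _; rewrite [y]tuple0 weight_eq1.
case: w ws w01 gw => // t0 w [ws] /andP[t01 w01] gw.
rewrite ge0_integral_cubeS//; last by move=> y; rewrite lee_fin weight_ge0.
apply: uniform_integral_gt0 t01 _.
- apply: (measurable_fun_fubini_tonelli_F (m2 := P n)
    (fun z => (weight k (u ++ tuple_cons z ++ v))%:E)).
    exact: (measurableT_comp (mW n.+1 u) (@measurable_tuple_cons R n)).
  by move=> z; rewrite lee_fin weight_ge0.
- by move=> t; apply: integral_ge0 => y _; rewrite lee_fin weight_ge0.
apply: filterS (near_avoids gw) => t gt.
have -> : (fun y : n.-tuple T => (weight k (u ++ tuple_cons (t, y) ++ v))%:E) =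
  (fun y : n.-tuple T => (weight k (rcons u t ++ y ++ v))%:E).
  by apply/funext => y; rewrite cat_rcons.
by apply: IH; exists w; rewrite cat_rcons.
Qed.

End positive_weight.

(** * Iterates of the operator on nonnegative functions *)

Section iterates.
Context (R : realType) (m : nat) (S : {set 'S_m.+1}).
Local Notation T := (measurableTypeR R).
Local Notation U := (uniform_prob (@ltr01 R)).
Local Notation P := (cube_measure R).

(** With extended real values, Tonelli applies to nonnegative functions without any integrability
    condition. *)
Definition eTfun (g : m.-tuple T -> \bar R) (x : m.-tuple T) : \bar R :=
  (\int[U]_t ((chi S (tuple_cons (t, x)))%:E * g (tuple_shift (t, x))))%E.

Lemma measurable_eTfun_integrand g : measurable_fun setT g ->
  measurable_fun setT (fun z : T * m.-tuple T =>
    (chi S (tuple_cons z))%:E * g (tuple_shift z))%E.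
Proof.
move=> mg; apply: emeasurable_funM.
  apply/measurable_EFinP.
  exact: (measurableT_comp (measurable_chi S) (@measurable_tuple_cons R m)).
exact: (measurableT_comp mg (@measurable_tuple_shift R m)).
Qed.

Lemma eTfun_ge0 g x : (forall y, 0 <= g y)%E -> (0 <= eTfun g x)%E.
Proof.
by move=> g0; apply: integral_ge0 => t _; rewrite mule_ge0// lee_fin chi_ge0.
Qed.

Lemma measurable_eTfun g : measurable_fun setT g -> (forall y, 0 <= g y)%E ->
  measurable_fun setT (eTfun g).
Proof.
move=> mg g0; apply: (measurable_fun_fubini_tonelli_G (m1 := U)
  (fun z => (chi S (tuple_cons z))%:E * g (tuple_shift z))%E).
  exact: measurable_eTfun_integrand.
by move=> z; rewrite mule_ge0// lee_fin chi_ge0.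
Qed.

Lemma window_cons0 (t : R) u : window m.+1 (t :: u) 0 = tuple_cons (t, window m u 0 : m.-tuple T).
Proof.
by apply: eq_from_tnth => -[[|i] im]; rewrite tnth_mktuple !(tnth_nth 0)//= nth_window.
Qed.

Lemma window_shift (t : R) u : window m (t :: u) 0 = tuple_shift (t, window m u 0 : m.-tuple T).
Proof.
apply: eq_from_tnth => i; rewrite tnth_mktuple (tnth_nth 0).
have := congr1 (fun s => nth 0 s i) (lastI t (window m u 0)).
rewrite nth_rcons size_belast size_tuple ltn_ord => <-.
by case: i => -[|i] im //=; rewrite nth_window// ltnW.
Qed.

Lemma weight_cons k (t : R) u :
  weight S k.+1 (t :: u) = weight S k u * chi S (tuple_cons (t, window m u 0 : m.-tuple T)).
Proof.
by rewrite /weight big_ord_recl window_cons0 mulrC.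
Qed.

Lemma iter_eTfun k g x : measurable_fun setT g -> (forall y, 0 <= g y)%E ->
  (iter k eTfun g x =
   \int[P k]_y ((weight S k (y ++ x))%:E * g (window m (y ++ x) 0)))%E.
Proof.
have mseq n := @measurable_seq_tuple_cat R n x.
have mG n g' : measurable_fun setT g' -> measurable_fun setT (fun y : n.-tuple T =>
    (weight S n (y ++ x))%:E * g' (window m (y ++ x) 0))%E.
  move=> mg'; apply: emeasurable_funM.
    by apply/measurable_EFinP; exact: measurable_weight.
  have mw := @measurable_window R _ _ (fun y : n.-tuple T => y ++ x) m 0 (mseq n).
  exact: (measurableT_comp mg' mw).
elim: k g => [|k IH] g mg g0.
  rewrite [RHS](eq_integral (cst (g x))).
    by rewrite integral_cst// [X in (_ * X)%E](probability_setT (P 0)) mule1.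
  move=> y _; rewrite [y]tuple0 /= /weight big_ord0 mul1e; congr g.
  by have := window_id x [::]; rewrite cats0.
(* Peeling off the innermost application makes its integration variable the new first letter of the
   word. *)
rewrite iterSr IH; [|exact: measurable_eTfun|by move=> y; exact: eTfun_ge0].
rewrite ge0_integral_cubeS; [|exact: mG|]; last first.
  by move=> y; rewrite mule_ge0// lee_fin weight_ge0.
(* The new first letter is integrated inside, with [y] fixed, since [weight S k (y ++ x)] does not
   depend on it. *)
rewrite (fubini_tonelli (m1 := U) (m2 := P k) (fun z =>
  (weight S k.+1 (tuple_cons z ++ x))%:E * g (window m (tuple_cons z ++ x) 0))%E).
- apply: eq_integral => y _; rewrite -ge0_integralZl//; last 3 first.
  + exact: (measurableT_comp (measurable_eTfun_integrand mg) (measurable_pair2 _)).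
  + by move=> t _; rewrite mule_ge0// lee_fin chi_ge0.
  + by rewrite lee_fin weight_ge0.
  by apply: eq_integral => t _; rewrite /= weight_cons EFinM muleA window_shift.
- exact: (measurableT_comp (mG k.+1 g mg) (@measurable_tuple_cons R k)).
- by move=> z; rewrite mule_ge0// lee_fin weight_ge0.
Qed.

Lemma iter_eTfun_gt0 g (x : m.-tuple T) :
  strongly_connected (edge S) ->
  increasing_perm m.+1 \notin S -> decreasing_perm m.+1 \notin S ->
  measurable_fun setT g -> (forall y, 0 <= g y)%E -> ~ (g = cst 0%E %[ae P m]) ->
  inside 0 1 (x : seq R) -> uniq (x : seq R) ->
  (0 < iter (m + (3 * #|{perm 'I_m}| + m)) eTfun g x)%E.
Proof.
move=> conn Si Sd mg g0 gN0 x01 xu; set n := (3 * _ + m)%N.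
have mseq := @measurable_seq_tuple_cat R (m + n) x.
have mG : measurable_fun setT (fun y : (m + n).-tuple T =>
    (weight S (m + n) (y ++ x))%:E * g (window m (y ++ x) 0))%E.
  apply: emeasurable_funM.
    by apply/measurable_EFinP; exact: measurable_weight.
  have mw := @measurable_window R _ _ (fun y : (m + n).-tuple T => y ++ x) m 0 mseq.
  exact: (measurableT_comp mg mw).
have G0 (y : (m + n).-tuple T) :
    (0 <= (weight S (m + n) (y ++ x))%:E * g (window m (y ++ x) 0))%E.
  by rewrite mule_ge0// lee_fin weight_ge0.
rewrite iter_eTfun// integral_cube_cat//.
(* The first window of [z ++ w ++ x] is [z], so the inner integral is [g z * c z], where [c z]
   collects the weights of all bridges from [z] to [x]. *)
pose c (z : m.-tuple T) := (\int[P n]_w (weight S (m + n) (z ++ w ++ x))%:E)%E.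
have mC : measurable_fun setT (fun v : m.-tuple T * n.-tuple T =>
    (weight S (m + n) (v.1 ++ v.2 ++ x))%:E).
  have := measurable_weight S (m + n) mseq.
  move/measurable_EFinP => h; have := measurableT_comp h (@measurable_tuple_cat R m n).
  by apply: eq_measurable_fun => v _ /=; rewrite catA.
have mc : measurable_fun setT c.
  apply: (measurable_fun_fubini_tonelli_F (m2 := P n) (fun v : m.-tuple T * n.-tuple T =>
    (weight S (m + n) (v.1 ++ v.2 ++ x))%:E)) => //.
  by move=> v; rewrite lee_fin weight_ge0.
have c0 z : (0 <= c z)%E by apply: integral_ge0 => w _; rewrite lee_fin weight_ge0.
rewrite (eq_integral (fun z => g z * c z)%E) => [|z _]; last first.
  under eq_integral => w _ do rewrite /= -catA window_id muleC.
  rewrite ge0_integralZl//.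
  - exact: (measurableT_comp mC (measurable_pair1 z)).
  - by move=> w _; rewrite lee_fin weight_ge0.
have gc0 z : (0 <= g z * c z)%E by exact: mule_ge0.
rewrite lt0e integral_ge0 ?andbT//.
apply/eqP => i0; apply: gN0.
have : (\int[P m]_z `|g z * c z| = 0)%E.
  by under eq_integral do rewrite gee0_abs//.
move/ae_eq_integral_abs => /(_ measurableT (emeasurable_funM mg mc)).
apply: filterS2 (ae_cube_generic R m) => z [z01 zu] /(_ I) /eqP gc _.
have cz : (0 < c z)%E.
  apply: integral_weight_gt0.
  have [w [ws w01 gw]] := good_bridge conn Si Sd xu zu x01 z01.
  exists w; split => // i im; apply: gw.
  (* The word [z ++ w ++ x] has [m + n + m] letters, hence [m + n] windows, one for each factor of
     the weight. *)
  by rewrite !size_cat !size_tuple ws addnA ltn_add2r.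
by move: gc; rewrite mule_eq0 (gt_eqF cz) orbF => /eqP.
Qed.

End iterates.

(** * Transfer to the operator on square-integrable classes *)

Section operator_iterates.
Context (R : realType) (m : nat) (S : {set 'S_m.+1}).
Local Notation T := (measurableTypeR R).
Local Notation U := (uniform_prob (@ltr01 R)).
Local Notation P := (cube_measure R m).
Local Notation L2 := (LspaceType2 P).

(** The integrand is at most 1 and the measure is a probability, so the integral is finite and
    [fine] loses nothing; the same bound allows iteration. *)
Lemma EFin_Tfun (g : m.-tuple T -> R) (x : m.-tuple T) :
  measurable_fun setT g -> (forall y, 0 <= g y <= 1) ->
  (Tfun S g x)%:E = eTfun S (EFin \o g) x /\ 0 <= Tfun S g x <= 1.
Proof.
move=> mg g01; have mgE : measurable_fun setT (EFin \o g) by exact/measurable_EFinP.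
have e0 : (0 <= eTfun S (EFin \o g) x)%E.
  by apply: eTfun_ge0 => y; rewrite lee_fin; case/andP: (g01 y).
have e1 : (eTfun S (EFin \o g) x <= 1)%E.
  apply: (@le_trans _ _ (\int[U]_t 1)%E); last first.
    by rewrite integral_cst// mul1e; exact: probability_le1.
  apply: ge0_le_integral => //.
  - by move=> t _; rewrite mule_ge0// lee_fin ?chi_ge0//; case/andP: (g01 (tuple_shift (t, x))).
  - exact: (measurableT_comp (measurable_eTfun_integrand S mgE) (measurable_pair2 x)).
  - move=> t _; rewrite -EFinM lee_fin; have /andP[g0 g1] := g01 (tuple_shift (t, x)).
    by rewrite mulr_ile1 ?chi_ge0 ?chi_le1.
have E : (Tfun S g x)%:E = eTfun S (EFin \o g) x.
  rewrite TfunE// /Rintegral fineK// ge0_fin_numE//.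
  exact: le_lt_trans e1 (ltry _).
by split => //; rewrite -!lee_fin E e0.
Qed.

Lemma iter_Tfun (g : m.-tuple T -> R) k :
  measurable_fun setT g -> (forall y, 0 <= g y <= 1) ->
  [/\ measurable_fun setT (iter k (Tfun S) g : m.-tuple T -> R),
      (forall y, 0 <= iter k (Tfun S) g y <= 1) &
      EFin \o iter k (Tfun S) g = iter k (eTfun S) (EFin \o g)].
Proof.
move=> mg g01; elim: k => [//|k [mk k01 kE]]; split.
- by rewrite iterS; exact: measurable_Tfun.
- by move=> y; rewrite iterS; have [_] := EFin_Tfun y mk k01.
- rewrite !iterS -kE; apply/funext => y /=.
  by have [-> _] := EFin_Tfun y mk k01.
Qed.

Lemma finite_norm_bounded (g : m.-tuple T -> R) :
  measurable_fun setT g -> (forall y, 0 <= g y <= 1) -> finite_norm P 2%:E g.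
Proof.
move=> mg g01; rewrite /finite_norm unlock.
apply: poweR_lty; apply: (@le_lt_trans _ _ (\int[P]_x 1)%E); last first.
  by rewrite integral_cst// mul1e;
    apply: (le_lt_trans (probability_le1 P measurableT)); exact: ltry.
apply: ge0_le_integral => //.
- by move=> x _; exact: poweR_ge0.
- exact: measurable_norm2.
- move=> x _; have /andP[g0 g1] := g01 x.
  rewrite -[leRHS](poweR1r 2) abse_EFin ger0_norm//; apply: gt0_ler_poweR => //.
  - by rewrite in_itv/= leey lee_fin g0.
  - by rewrite in_itv/= leey lee01.
Qed.

(* The library's linear structure on representatives is only almost everywhere,
   so monotonicity is obtained from the nonnegative function [`|h - g|], which
   represents [h - g]. *)
Lemma pattern_operator_ge (g : m.-tuple T -> R) (h : L2) :
  measurable_fun setT g -> (forall y, 0 <= g y <= 1) ->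
  {ae P, forall x, g x <= h x} ->
  {ae P, forall x, Tfun S g x <= pattern_operator R S h x}.
Proof.
move=> mg g01 gh.
have mh := measurable_L2 h.
pose r x := `|h x - g x|.
have mr : measurable_fun setT r by apply: measurableT_comp => //; exact: measurable_funB.
have rE : r = (fun x => (-1) * g x + h x) %[ae P].
  apply: filterS gh => x gx _; rewrite /r ger0_norm ?subr_ge0//; lra.
have := ae_Tfun_linear S mg mh mr (finite_norm_bounded mg g01) (finite_norm_L2 h) rE.
apply: filterS2 (pattern_operator_funE S h) => x /(_ I) /= -> /(_ I) E.
have : 0 <= Tfun S r x by apply: Rintegral_ge0 => t _; rewrite mulr_ge0 ?chi_ge0// normr_ge0.
by rewrite E; lra.
Qed.

Lemma iter_pattern_operator_ge (g : m.-tuple T -> R) (f : L2) k :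
  measurable_fun setT g -> (forall y, 0 <= g y <= 1) ->
  {ae P, forall x, g x <= f x} ->
  {ae P, forall x, iter k (Tfun S) g x <= iter k (pattern_operator R S) f x}.
Proof.
move=> mg g01 gf; elim: k => [//|k IH]; rewrite !iterS.
by have [mk k01 _] := iter_Tfun k mg g01; exact: pattern_operator_ge.
Qed.

End operator_iterates.

Theorem theorem1p3 (R : realType) (m : nat) (S : {set 'S_m.+1})
    (m_ge2 : (2 <= m)%N)
    (G_connected : strongly_connected (edge S))
    (S_incr : increasing_perm m.+1 \notin S)
    (S_decr : decreasing_perm m.+1 \notin S) :
  positivity_improving (pattern_operator R S).
Proof.
(* The first [m] letters are the window read by [f], the others form the bridge of [good_bridge];
   the exponent is the same for all [f]. *)
move=> f f0 fN0; exists (m + (3 * #|{perm 'I_m}| + m))%N.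
(* The integral in [Tfun] is the junk value [0] when it diverges; truncating [f]
   keeps all the iterates in [0, 1]. *)
pose g (x : m.-tuple (measurableTypeR R)) : R := Num.min `|f x| 1.
have mg : measurable_fun setT g.
  apply: measurable_minr; last exact: measurable_cst.
  by apply: measurableT_comp => //; exact: measurable_L2.
have g01 y : 0 <= g y <= 1 by rewrite le_min normr_ge0 ler01 ge_min lexx orbT.
have gf : {ae cube_measure R m, forall x, g x <= f x}.
  by apply: filterS f0 => x fx; rewrite ge_min ger0_norm// lexx.
(* Truncation at 1 creates no new zeros. *)
have gN0 : ~ (EFin \o g = cst 0%E %[ae cube_measure R m]).
  apply: contra_not fN0; apply: filterS => x /(_ I) /= [gx] _.
  apply/eqP; rewrite -normr_eq0; move: gx; rewrite /g /Num.min; case: ifP => _ /eqP//.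
  by rewrite oner_eq0.
set k := (m + _)%N.
have [_ _ kE] := iter_Tfun S k mg g01.
have A := iter_pattern_operator_ge S k mg g01 gf.
have B := ae_cube_generic R m.
apply: filterS2 B A => x [x01 xu] gfx.
apply: lt_le_trans gfx; rewrite -lte_fin -[ltRHS]/((EFin \o iter k (Tfun S) g) x) kE.
apply: iter_eTfun_gt0 => //; first exact/measurable_EFinP.
by move=> y; rewrite lee_fin; case/andP: (g01 y).
Qed.
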